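(* Let $n\geq 2$ be an integer and let $X$ be an $n$-Hausdorff topological space. Then $|X|\leq nw(X)^{\,n\text{-}\psi(X)}$.
   Context: Throughout $n\ge 2$ is an integer. The Hausdorff number $H(X)$ of a space $X$ is the least cardinal $\kappa$ such that for every $A\subseteq X$ with $|A|\geq\kappa$ there exist open neighbourhoods $U_a$ of $a$ ($a\in A$) with $\bigcap_{a\in A}U_a=\emptyset$. $X$ is $n$-Hausdorff if $H(X)\leq n$. No other separation axiom is assumed. For an $n$-Hausdorff space $X$, the $n$-pseudocharacter $n\text{-}\psi(X)$ is the minimum infinite cardinal $\kappa$ such that for each point $x\in X$ there is a collection $\{V(\alpha,x):\alpha<\kappa\}$ of open neighbourhoods of $x$ such that whenever $x_1,\dots,x_n\in X$ are $n$ different points, $\bigcap_{\alpha<\kappa}V(\alpha,x_1)\cap\dots\cap\bigcap_{\alpha<\kappa}V(\alpha,x_n)=\emptyset$. $nw(X)$ is the net-weight (least cardinality of a network) of $X$, multiplied by $\omega$ (so it is always infinite). *)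

(* Defs.v *)
From mathcomp Require Import all_boot all_order.
From mathcomp Require Import boolp classical_sets functions cardinality topology.

Set Implicit Arguments.
Unset Strict Implicit.
Unset Printing Implicit Defensive.

Local Open Scope classical_set_scope.
Local Open Scope card_scope.

Lemma card_le_setTP (T U : Type) (B : set U) :
  [set: T] #<= B <-> exists2 f : T -> U, injective f & forall x, B (f x).
Proof.
split=> [/card_leP[f]|[f finj fB]].
  exists (fun x => set_val (f (to_setT x))) => [x y|x]; last exact: set_valP.
  by move=> /val_inj /(@inj _ _ _ f); rewrite !inE => /(_ I I) [].
have [g] : $|{injfun [set: T] >-> B}|.
  by apply/injfunPex; exists f => [x _|x y _ _]; [exact: fB|exact: finj].
exact: inj_card_le g.
Qed.

(* A cardinal number is represented by any type of that cardinality; `#<=`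
   between full sets is the order of cardinals and `L -> K` is K ^ L. *)

Definition is_least_cardinal (P : Type -> Prop) (K : Type) : Prop :=
  P K /\ forall L : Type, P L -> [set: K] #<= [set: L].

(* The junk value `void` is only taken when no cardinal satisfies P: see
   least_cardinalP. *)
Definition least_cardinal (P : Type -> Prop) : Type :=
  if pselect (exists K, is_least_cardinal P K) is left e
  then projT1 (cid e) else void.

(* A maximal subset of the product on which every projection is injective
   projects onto one of the factors, which then injects into all of them. *)
Lemma least_in_family (J : Type) (F : J -> Type) :
  J -> exists j, forall k, [set: F j] #<= [set: F k].
Proof.
move=> j0; pose T := forall j : J, F j.
pose inj (R : set T) := forall j f g, R f -> R g -> f j = g j -> f = g.
have [G GP Gtot|R [injR Rmax]] := @Zorn_bigcup T inj.
  move=> j f g [A GA Af] [B GB Bg] fg.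
  have [AB|BA] := Gtot _ _ GA GB.
  - by apply: (GP _ GB j) => //; exact: AB.
  - by apply: (GP _ GA j) => //; exact: BA.
have [j jsurj] : exists j : J, forall y : F j, exists2 f, R f & f j = y.
  apply: contrapT => /forallNP noj.
  have miss (j : J) : {y : F j | forall f, R f -> f j <> y}.
    apply: cid; have /existsNP[y ny] := noj j.
    by exists y => f Rf fy; apply: ny; exists f.
  pose h : T := fun j => sval (miss j).
  have hP (j : J) f : R f -> f j <> h j by exact: (svalP (miss j)).
  apply: (Rmax (R `|` [set h])); last first.
    move=> j f g [Rf|->] [Rg|->] //.
    - exact: injR.
    - by move=> /(hP j f Rf).
    - by move=> /esym /(hP j g Rg).
  split; first by move=> f Rf; left.
  move=> /(_ h (or_intror erefl)) Rh.
  exact: (hP j0 h Rh).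
exists j => k.
have /choice[s sP] : forall y : F j, exists f, R f /\ f j = y.
  by move=> y; have [f] := jsurj y; exists f.
apply/card_le_setTP; exists (fun y => s y k) => // y z yz.
have [[Ry <-] [Rz <-]] := (sP y, sP z).
by rewrite (injR k _ _ Ry Rz yz).
Qed.

Lemma card_le_setT_total (K L : Type) :
  [set: K] #<= [set: L] \/ [set: L] #<= [set: K].
Proof.
have [[] le] := @least_in_family bool (fun b => if b then K else L) true.
- by left; exact: (le false).
- by right; exact: (le true).
Qed.

Lemma is_least_cardinal_exists (P : Type -> Prop) :
  (exists K, P K) -> exists K, is_least_cardinal P K.
Proof.
move=> [K0 PK0].
pose J := {A : set K0 | exists L, P L /\ [set: L] #= A}.
have j0 : J by exists setT; exists K0; split=> //; exact: card_eqxx.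
have [[A [K [PK KA]]] /= Amin] :=
  @least_in_family J (fun j => set_type (sval j)) j0.
have {}Amin (B : set K0) L : P L -> [set: L] #= B -> A #<= B.
  move=> PL LB; have QB : exists L, P L /\ [set: L] #= B by exists L.
  have /= := Amin (exist _ B QB).
  by rewrite (card_le_eql (card_setT A)) (card_le_eqr (card_setT B)).
exists K; split=> // L PL; rewrite (card_le_eql KA).
have [K0L|LK0] := card_le_setT_total K0 L.
  exact: card_le_trans (subset_card_le (@subsetT _ A)) K0L.
have /card_le_setTP[f finj _] := LK0.
have LB : [set: L] #= range f by apply/card_esym/inj_card_eq => x y _ _ /finj.
by rewrite (card_le_eqr LB); exact: Amin PL LB.
Qed.

Lemma least_cardinalP (P : Type -> Prop) :
  (exists K, P K) -> is_least_cardinal P (least_cardinal P).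
Proof.
move=> /is_least_cardinal_exists exK; rewrite /least_cardinal.
by case: pselect => // e; case: (cid e).
Qed.

Definition separates_sets_of_size (X : topologicalType) (K : Type) : Prop :=
  forall A : set X, [set: K] #<= A ->
    exists U : X -> set X,
      (forall a, A a -> open_nbhs a (U a)) /\ \bigcap_(a in A) U a = set0.

Definition hausdorff_number (X : topologicalType) : Type :=
  least_cardinal (separates_sets_of_size X).

Definition n_hausdorff (n : nat) (X : topologicalType) : Prop :=
  [set: hausdorff_number X] #<= `I_n.

Definition separates_n_points (n : nat) (X : topologicalType) (K : Type) :
    Prop :=
  exists V : K -> X -> set X,
    (forall k x, open_nbhs x (V k x)) /\
    forall x : 'I_n -> X, injective x ->
      \bigcap_(i in [set: 'I_n]) \bigcap_(k in [set: K]) V k (x i) = set0.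

Definition n_pseudocharacter (n : nat) (X : topologicalType) : Type :=
  least_cardinal (fun K =>
    infinite_set [set: K] /\ separates_n_points n X K).

Definition network (X : topologicalType) (N : set (set X)) : Prop :=
  forall (x : X) (U : set X), open_nbhs x U ->
    exists S : set X, [/\ N S, S x & S `<=` U].

Definition has_network_of_size (X : topologicalType) (K : Type) : Prop :=
  exists N : set (set X), network N /\ [set: K] #= N.

(* nat stands for omega. The product is infinite as soon as X is nonempty; on
   the empty space the least network is empty and so is the product, which is
   then 0 instead of omega. *)
Definition net_weight (X : topologicalType) : Type :=
  (least_cardinal (has_network_of_size X) * nat)%type.

Lemma hausdorff_numberP (X : topologicalType) :
  is_least_cardinal (separates_sets_of_size X) (hausdorff_number X).
Proof.
apply: least_cardinalP; exists (set X) => A /card_le_setTP[f finj _].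
pose D := [set x | exists2 B : set X, f B = x & ~ B x].
have fD : D (f D) <-> ~ D (f D).
  split=> [[B fB nB] _|nD]; last by exists D.
  have BD : B = D by exact: finj fB.
  by apply: (nB); rewrite BD; exists B.
have nD : ~ D (f D) by move=> d; exact: (fD.1 d d).
by case: (nD (fD.2 nD)).
Qed.

Lemma n_pseudocharacterP (n : nat) (X : topologicalType) : n_hausdorff n X ->
  is_least_cardinal
    (fun K => infinite_set [set: K] /\ separates_n_points n X K)
    (n_pseudocharacter n X).
Proof.
move=> nX; apply: least_cardinalP; exists (nat + set X)%type; split.
  by apply/infiniteP/card_le_setTP; exists inl => // a b [].
pose V (k : nat + set X) x :=
  if k is inr U then if pselect (open_nbhs x U) then U else setT else setT.
have VT (x : X) : open_nbhs x setT by split=> //; exact: openT.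
exists V; split=> [[m|U] x|x xinj] /=; [exact: VT | by case: pselect|].
have [sepX _] := hausdorff_numberP X.
have [|U [Uo U0]] := sepX (range x).
  apply: card_le_trans nX _; rewrite (card_le_eql card_II).
  by apply/card_le_setTP; exists x => // i; exists i.
rewrite -subset0 -U0 => y Vy _ [i _ <-].
have := Vy i I (inr (U (x i))) I; rewrite /V.
by case: pselect => // nU; case: nU; apply: Uo; exists i.
Qed.

Lemma network_sizeP (X : topologicalType) :
  is_least_cardinal (has_network_of_size X)
    (least_cardinal (has_network_of_size X)).
Proof.
apply: least_cardinalP; exists (set X), setT; split; last exact: card_eqxx.
by move=> x U [oU Ux]; exists U; split=> //.
Qed.

(* Main.v *)
Require Import Defs.
From mathcomp Require Import all_boot all_order.
From mathcomp Require Import boolp classical_sets functions cardinality topology.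

Local Open Scope classical_set_scope.
Local Open Scope card_scope.

(** Let K be the n-pseudocharacter, witnessed by neighbourhoods V k x, and let
    N be a network of least size L.  For each point x choose s x : K -> N with
    x in s x k and s x k contained in V k x.  If n different points had the
    same s, each of them would lie in every common member s _ k, hence in the
    intersection of all the sets V k _ attached to these points, which is
    empty.  So s has finite fibres ([finite_common_refinement]), and it yields
    an embedding of X into (K -> L) * nat ([card_le_finite_to_one]).  As K is
    nonempty, this product embeds into K -> L * nat ([card_le_fun_prod]). *)

Lemma card_le_finite_to_one (T U : Type) (f : T -> U) :
  (forall u, finite_set (f @^-1` [set u])) ->
  [set: T] #<= [set: (U * nat)%type].
Proof.
move=> fin_f.
have /choice[e einj] : forall u, exists g : T -> nat,
    set_inj (f @^-1` [set u]) g.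
  by move=> u; apply/countable_injP; exact: finite_set_countable.
apply/card_le_setTP; exists (fun x => (f x, e (f x) x)) => // x y [fxy exy].
by apply: (einj (f x)); rewrite ?inE //= exy fxy.
Qed.

Lemma card_le_fun_prod (K L M : Type) : K ->
  [set: ((K -> L) * M)%type] #<= [set: K -> L * M].
Proof.
move=> k0; apply/card_le_setTP.
exists (fun p k => (p.1 k, p.2)) => // -[f a] [g b] /= fg.
have ab : a = b by have /(congr1 (fun h => (h k0).2)) := fg.
rewrite ab; congr pair; apply/funext => k.
by have /(congr1 (fun h => (h k).1)) := fg.
Qed.

(** An infinite [A] would contain [n] different points, and any point of [A]
    lies in every [S k], hence in all the sets [V k x] attached to them. *)
Lemma finite_common_refinement (n : nat) (X K : Type) (V : K -> X -> set X)
    (S : K -> set X) (A : set X) :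
  (forall x : 'I_n -> X, injective x ->
    \bigcap_(i in [set: 'I_n]) \bigcap_(k in [set: K]) V k (x i) = set0) ->
  (forall x k, A x -> S k x /\ S k `<=` V k x) -> finite_set A.
Proof.
move=> sepV SV; apply: contrapT => /infiniteP /card_le_setTP[h hinj hA].
have : set0 (h 0).
  rewrite -(sepV (fun i : 'I_n => h i)) => [i _ k _|i j /hinj /val_inj //].
  by apply: (SV (h i) k (hA i)).2; exact: (SV (h 0) k (hA 0)).1.
by [].
Qed.

Theorem theorem2p8 (n : nat) (hn : (2 <= n)%N) (X : topologicalType)
    (hX : n_hausdorff n X) :
  [set: X] #<= [set: n_pseudocharacter n X -> net_weight X].
Proof.
have [[Kinf [V [Vnbhs sepV]]] _] := n_pseudocharacterP hX.
have [[N [netN LN]] _] := network_sizeP X.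
rewrite /net_weight; set K := n_pseudocharacter n X in V Kinf Vnbhs sepV *.
set L := least_cardinal _ in LN *.
have [k0 _] : [set: K] !=set0 by exact: infinite_setN0.
have /choice[s sP] : forall x, exists sx : K -> N,
    forall k, set_val (sx k) x /\ set_val (sx k) `<=` V k x.
  move=> x; have /choice[sx sxP] : forall k, exists S : N,
      set_val S x /\ set_val S `<=` V k x; last by exists sx.
  move=> k; have [S [NS Sx SV]] := netN _ _ (Vnbhs k x).
  by exists (SigSub (mem_set NS)).
have /card_le_setTP[c cinj _] : [set: N] #<= [set: L].
  by rewrite (card_le_eql (card_setT N)) (card_le_eqr LN).
apply: card_le_trans (card_le_fun_prod _ _ _ k0).
apply: (card_le_finite_to_one _ _ (fun x => c \o s x)) => f.
have [->|/set0P[x0 fx0]] := eqVneq ((fun x => c \o s x) @^-1` [set f]) set0.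
  exact: finite_set0.
apply: (finite_common_refinement n X K V (fun k => set_val (s x0 k))) => //.
move=> x k fx.
have <- : s x k = s x0 k.
  apply: cinj; have csE : c \o s x = c \o s x0 by rewrite fx fx0.
  by have /(congr1 (fun h => h k)) := csE.
exact: sP.
Qed.
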